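(* If the surfaces $\varphi_e$ and $\varphi_{e_1}$ form a Mannheim surface offset with dual Lorentzian offset angle $\bar\theta$, then the dual conical curvature $\bar\gamma_1$ of $\varphi_{e_1}$ is $$\bar\gamma_1=-\tanh\bar\theta.$$
   Context: Minkowski space $\mathbb{R}^3_1$ is $\mathbb{R}^3$ with $\langle \vec a,\vec b\rangle=-a_1b_1+a_2b_2+a_3b_3$, and the Lorentzian cross product is $\vec a\times\vec b=(a_2b_3-a_3b_2,\ a_1b_3-a_3b_1,\ a_2b_1-a_1b_2)$. Dual numbers are $a+\varepsilon a^*$ with $a,a^*\in\mathbb{R}$, $\varepsilon^2=0$; dual vectors are $\vec a+\varepsilon\vec a^*$ with $\vec a,\vec a^*\in\mathbb{R}^3_1$; inner and cross products extend bilinearly over the dual numbers. A differentiable real function $f$ extends to dual numbers by $f(x+\varepsilon x^* )=f(x)+\varepsilon x^*f'(x)$. First surface (spacelike ruled surface): $\varphi_e(s,v)=\vec c(s)+v\,\vec e(s)$ with smooth $\vec c,\vec e$ on an interval containing $0$, $\langle\vec e,\vec e\rangle=1$, $\langle\vec e\,',\vec e\,'\rangle=-1$, $\langle\vec c\,',\vec e\,'\rangle=0$ (prime is $d/ds$; $s$ is the arc-length of the indicatrix $\vec e$, and $\vec c$ is the striction curve). Put $\vec t=\vec e\,'$, $\vec g=-\vec e\times\vec t$; then $\vec t\,'=\vec e+\gamma\vec g$, $\vec g\,'=\gamma\vec t$, which defines the conical curvature $\gamma$. Put $\Delta=\det(\vec c\,',\vec e,\vec t)$, $\delta=\langle\vec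 c\,',\vec e\rangle$, and $\tilde x=\vec x+\varepsilon\,\vec c\times\vec x$ for $\vec x=\vec e,\vec t,\vec g$. The dual arc-length is $\bar s=s+\varepsilon s^*$, $s^*=\int_0^s\Delta\,du$. The dual Darboux frame $\{\tilde e,\tilde t,\tilde g\}$ satisfies $\frac{d\tilde e}{d\bar s}=\tilde t$, $\frac{d\tilde t}{d\bar s}=\tilde e+\bar\gamma\tilde g$, $\frac{d\tilde g}{d\bar s}=\bar\gamma\tilde t$ with $\bar\gamma=\gamma-\varepsilon(\delta+\gamma\Delta)$. Second surface (timelike ruled surface with timelike rulings): $\varphi_{e_1}(s_1,v)=\vec c_1(s_1)+v\,\vec e_1(s_1)$ with $\langle\vec e_1,\vec e_1\rangle=-1$, $s_1$ the arc-length of the indicatrix $\vec e_1$, $\vec t_1=\frac{d\vec e_1}{ds_1}$ with $\langle\vec t_1,\vec t_1\rangle=1$, $\langle\frac{d\vec c_1}{ds_1},\vec t_1\rangle=0$ ($\vec c_1$ is the striction curve). Put $\Delta_1=\det(\frac{d\vec c_1}{ds_1},\vec e_1,\vec t_1)$ and $\delta_1=\langle\frac{d\vec c_1}{ds_1},\vec e_1\rangle$. Its dual arc-length is $\bar s_1=s_1+\varepsilon s_1^*$, $s_1^*=-\int_0^{s_1}\Delta_1du_1$. Its dual Darboux frame is $\{\tilde e_1,\tilde t_1,\tilde g_1\}$, $\tilde x_1=\vec x_1+\varepsilon\,\vec c_1\times\vec x_1$, with $\tilde t_1=\frac{d\tilde e_1}{d\bar s_1}$. Its conical curvature is $\gamma_1=-\langle\frac{d\vec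 g_1}{ds_1},\vec t_1\rangle$ and its dual conical curvature is $\bar\gamma_1=\gamma_1+\varepsilon(\delta_1+\gamma_1\Delta_1)$. Mannheim offsets: $\varphi_e$ and $\varphi_{e_1}$ (with corresponding points, $s_1$ being a regular function of $s$, i.e. $\frac{ds_1}{ds}\neq0$) form a Mannheim surface offset if $\tilde g(\bar s)=\tilde t_1(\bar s_1)$. The frames are then related by $$\tilde e_1=\sinh\bar\theta\,\tilde e+\cosh\bar\theta\,\tilde t,\quad \tilde t_1=\tilde g,\quad \tilde g_1=\cosh\bar\theta\,\tilde e+\sinh\bar\theta\,\tilde t,$$ where the dual function $\bar\theta=\theta+\varepsilon\theta^*$ is the dual Lorentzian offset angle; the real functions $\theta$ and $\theta^*$ are called the offset angle and the offset distance. Quantities of the two surfaces are compared at corresponding parameters $s$, $s_1$. *)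

(* Defs.v *)
From Stdlib Require Import Reals.
From Coquelicot Require Import Coquelicot.
Open Scope R_scope.

(** * Minkowski 3-space, signature (-,+,+) *)

Record vec3 : Type := mkvec3 { vx1 : R; vx2 : R; vx3 : R }.

Definition vadd (a b : vec3) : vec3 :=
  mkvec3 (vx1 a + vx1 b) (vx2 a + vx2 b) (vx3 a + vx3 b).

Definition vscal (k : R) (a : vec3) : vec3 :=
  mkvec3 (k * vx1 a) (k * vx2 a) (k * vx3 a).

Definition vopp (a : vec3) : vec3 := mkvec3 (- vx1 a) (- vx2 a) (- vx3 a).

Definition linner (a b : vec3) : R :=
  - vx1 a * vx1 b + vx2 a * vx2 b + vx3 a * vx3 b.

(** The signs are those for which [linner (lcross a b) c = - det3 a b c]. *)
Definition lcross (a b : vec3) : vec3 :=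
  mkvec3 (vx2 a * vx3 b - vx3 a * vx2 b)
         (vx1 a * vx3 b - vx3 a * vx1 b)
         (vx2 a * vx1 b - vx1 a * vx2 b).

Definition det3 (a b c : vec3) : R :=
  vx1 a * (vx2 b * vx3 c - vx3 b * vx2 c)
  - vx2 a * (vx1 b * vx3 c - vx3 b * vx1 c)
  + vx3 a * (vx1 b * vx2 c - vx2 b * vx1 c).

Definition vderive (f : R -> vec3) (s : R) : vec3 :=
  mkvec3 (Derive (fun u => vx1 (f u)) s)
         (Derive (fun u => vx2 (f u)) s)
         (Derive (fun u => vx3 (f u)) s).

(** Derivatives are two-sided: at an endpoint belonging to [I] the curve is
    the restriction of one defined and differentiable around that endpoint. *)
Definition smooth_on (I : R -> Prop) (f : R -> vec3) : Prop :=
  forall s, I s -> forall n : nat,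
    ex_derive_n (fun u => vx1 (f u)) n s /\
    ex_derive_n (fun u => vx2 (f u)) n s /\
    ex_derive_n (fun u => vx3 (f u)) n s.

(** Nondegenerate interval, with or without its endpoints, bounded or not. *)
Definition is_interval (I : R -> Prop) : Prop :=
  (forall x y z, I x -> I z -> x <= y <= z -> I y) /\
  (exists x y, I x /\ I y /\ x < y).

(** * Dual numbers [re + eps * du] and dual vectors [vre + eps * vdu] *)

Record dual : Type := mkdual { re : R; du : R }.

Definition dopp (x : dual) : dual := mkdual (- re x) (- du x).

Definition dual_ext (f : R -> R) (x : dual) : dual :=
  mkdual (f (re x)) (du x * Derive f (re x)).

Record dvec3 : Type := mkdvec3 { vre : vec3; vdu : vec3 }.

Definition dvadd (a b : dvec3) : dvec3 :=
  mkdvec3 (vadd (vre a) (vre b)) (vadd (vdu a) (vdu b)).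

Definition dvscal (k : dual) (a : dvec3) : dvec3 :=
  mkdvec3 (vscal (re k) (vre a))
          (vadd (vscal (re k) (vdu a)) (vscal (du k) (vre a))).

(** * Ruled surfaces [(s, v) |-> striction s + v * ruling s] *)

Record ruled_surface : Type :=
  mkruled { striction : R -> vec3; ruling : R -> vec3 }.

Definition frame_e (S : ruled_surface) (s : R) : vec3 := ruling S s.

Definition frame_t (S : ruled_surface) (s : R) : vec3 := vderive (ruling S) s.

(** The orientation [g = - e x t] is used for both causal types of rulings. For
    timelike rulings it is the one compatible with the frame relations in
    [dual_offset_angle]. *)
Definition frame_g (S : ruled_surface) (s : R) : vec3 :=
  vopp (lcross (frame_e S s) (frame_t S s)).

(** Dual vector [x + eps (c x x)] of the line through [c s] directed by [x s]. *)
Definition dual_line (S : ruled_surface) (x : R -> vec3) (s : R) : dvec3 :=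
  mkdvec3 (x s) (lcross (striction S s) (x s)).

Definition dual_e (S : ruled_surface) : R -> dvec3 := dual_line S (frame_e S).
Definition dual_t (S : ruled_surface) : R -> dvec3 := dual_line S (frame_t S).
Definition dual_g (S : ruled_surface) : R -> dvec3 := dual_line S (frame_g S).

Definition Delta (S : ruled_surface) (s : R) : R :=
  det3 (vderive (striction S) s) (frame_e S s) (frame_t S s).

Definition delta (S : ruled_surface) (s : R) : R :=
  linner (vderive (striction S) s) (frame_e S s).

(** The parameter is the arc-length of the indicatrix [ruling S], and
    [striction S] is the striction curve; spacelike rulings with timelike
    derivative. *)
Definition spacelike_ruled (I : R -> Prop) (S : ruled_surface) : Prop :=
  smooth_on I (striction S) /\ smooth_on I (ruling S) /\
  forall s, I s ->
    linner (frame_e S s) (frame_e S s) = 1 /\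
    linner (frame_t S s) (frame_t S s) = -1 /\
    linner (vderive (striction S) s) (frame_t S s) = 0.

(** Same normalization, with timelike rulings. *)
Definition timelike_ruled (I : R -> Prop) (S : ruled_surface) : Prop :=
  smooth_on I (striction S) /\ smooth_on I (ruling S) /\
  forall s, I s ->
    linner (frame_e S s) (frame_e S s) = -1 /\
    linner (frame_t S s) (frame_t S s) = 1 /\
    linner (vderive (striction S) s) (frame_t S s) = 0.

(** Conical curvature and dual conical curvature of a surface with timelike
    rulings; the signs differ from those of the spacelike case. *)
Definition conical_curvature (S : ruled_surface) (s : R) : R :=
  - linner (vderive (frame_g S) s) (frame_t S s).

Definition dual_conical_curvature (S : ruled_surface) (s : R) : dual :=
  mkdual (conical_curvature S s)
         (delta S s + conical_curvature S s * Delta S s).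

(** * Mannheim offsets *)

(** [s1] sends a parameter of [S] to the corresponding parameter of [S1]. *)
Definition mannheim_offset (I I1 : R -> Prop) (S S1 : ruled_surface)
    (s1 : R -> R) : Prop :=
  forall s, I s ->
    I1 (s1 s) /\ ex_derive s1 s /\ Derive s1 s <> 0 /\
    dual_g S s = dual_t S1 (s1 s).

(** [Theta s = theta s + eps * theta* s]: offset angle and offset distance. *)
Definition dual_offset_angle (I : R -> Prop) (S S1 : ruled_surface)
    (s1 : R -> R) (Theta : R -> dual) : Prop :=
  forall s, I s ->
    dual_e S1 (s1 s) =
      dvadd (dvscal (dual_ext sinh (Theta s)) (dual_e S s))
            (dvscal (dual_ext cosh (Theta s)) (dual_t S s)) /\
    dual_g S1 (s1 s) =
      dvadd (dvscal (dual_ext cosh (Theta s)) (dual_e S s))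
            (dvscal (dual_ext sinh (Theta s)) (dual_t S s)).

(* Main.v *)
Require Import Defs.
From Stdlib Require Import Reals Lra.
From Coquelicot Require Import Coquelicot.
Open Scope R_scope.

(** The derivatives of the identities [<e1, g> = <g1, g> = 0] along the curve
    express [ds1/ds] and [<dg1/ds1, t1>] through [<t, dg/ds>], and their
    quotient is [tanh theta]. The dual part of the frame relations says that
    [c1 - c] is [theta*] times [g], so it is orthogonal to [e1] and [g1];
    differentiating these two identities gives [delta1] and
    [Delta1 = <dc1/ds1, g1>]. *)

(** * Algebra of the Lorentzian inner and cross products *)

Lemma vec3_eq (a b : vec3) :
  vx1 a = vx1 b -> vx2 a = vx2 b -> vx3 a = vx3 b -> a = b.
Proof. destruct a, b; simpl; intros -> -> ->; reflexivity. Qed.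

Lemma linner_sym (a b : vec3) : linner a b = linner b a.
Proof. unfold linner; ring. Qed.

Lemma linner_addl (a b c : vec3) :
  linner (vadd a b) c = linner a c + linner b c.
Proof. unfold linner, vadd; simpl; ring. Qed.

Lemma linner_scall (k : R) (a c : vec3) :
  linner (vscal k a) c = k * linner a c.
Proof. unfold linner, vscal; simpl; ring. Qed.

Lemma linner_oppl (a c : vec3) : linner (vopp a) c = - linner a c.
Proof. unfold linner, vopp; simpl; ring. Qed.

Lemma linner_addr (a b c : vec3) :
  linner c (vadd a b) = linner c a + linner c b.
Proof. unfold linner, vadd; simpl; ring. Qed.

Lemma linner_scalr (k : R) (a c : vec3) :
  linner c (vscal k a) = k * linner c a.
Proof. unfold linner, vscal; simpl; ring. Qed.

Lemma linner_lcross_l (a b : vec3) : linner (lcross a b) a = 0.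
Proof. unfold linner, lcross; simpl; ring. Qed.

Lemma linner_lcross_r (a b : vec3) : linner (lcross a b) b = 0.
Proof. unfold linner, lcross; simpl; ring. Qed.

(** Lagrange identity, with the sign opposite to the Euclidean one: this is what makes [g] spacelike
    when [e] is spacelike and [t] timelike. *)
Lemma linner_lcross_lcross (a b : vec3) :
  linner (lcross a b) (lcross a b)
  = linner a b * linner a b - linner a a * linner b b.
Proof. unfold linner, lcross; simpl; ring. Qed.

(** With [b = e] and [c = t] the right-hand vector is [frame_g], so [Delta] becomes the
    [g]-component of the derivative of the striction curve. *)
Lemma det3_linner (a b c : vec3) : det3 a b c = linner a (vopp (lcross b c)).
Proof. unfold det3, linner, vopp, lcross; simpl; ring. Qed.

Lemma lcross_lcross (a b : vec3) :
  lcross (lcross a b) b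
  = vadd (vscal (linner a b) (vopp b)) (vscal (linner b b) a).
Proof.
  apply vec3_eq; unfold lcross, vadd, vscal, vopp, linner; simpl; ring.
Qed.

Lemma lcross_subl (a b c : vec3) :
  lcross (vadd a (vopp b)) c = vadd (lcross a c) (vopp (lcross b c)).
Proof. apply vec3_eq; unfold lcross, vadd, vopp; simpl; ring. Qed.

(** The double cross product [(w x g) x g] equals [w - <w, g> g] for such a [g], and it vanishes
    here. *)
Lemma lcross_eq0_unit (w g : vec3) :
  linner g g = 1 -> lcross w g = mkvec3 0 0 0 -> w = vscal (linner w g) g.
Proof.
  intros Hg Hw; generalize (lcross_lcross w g); rewrite Hw, Hg.
  generalize (linner w g); intros k Hk.
  assert (H1 := f_equal vx1 Hk); assert (H2 := f_equal vx2 Hk).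
  assert (H3 := f_equal vx3 Hk); simpl in H1, H2, H3.
  apply vec3_eq; simpl; lra.
Qed.

(** * Differentiation of curves in Minkowski space *)

(** [vderive] is total and carries no guarantee of differentiability; this relation also asserts
    that the derivatives exist, so the sum, chain and product rules apply. *)
Definition is_vderive (f : R -> vec3) (s : R) (l : vec3) : Prop :=
  is_derive (fun u => vx1 (f u)) s (vx1 l) /\
  is_derive (fun u => vx2 (f u)) s (vx2 l) /\
  is_derive (fun u => vx3 (f u)) s (vx3 l).

Lemma is_vderive_add (f g : R -> vec3) (s : R) (a b : vec3) :
  is_vderive f s a -> is_vderive g s b ->
  is_vderive (fun u => vadd (f u) (g u)) s (vadd a b).
Proof.
  intros (F1 & F2 & F3) (G1 & G2 & G3); split; [| split]; simpl.
  - exact (is_derive_plus _ _ _ _ _ F1 G1).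
  - exact (is_derive_plus _ _ _ _ _ F2 G2).
  - exact (is_derive_plus _ _ _ _ _ F3 G3).
Qed.

Lemma is_vderive_opp (f : R -> vec3) (s : R) (a : vec3) :
  is_vderive f s a -> is_vderive (fun u => vopp (f u)) s (vopp a).
Proof.
  intros (F1 & F2 & F3); split; [| split]; simpl.
  - exact (is_derive_opp _ _ _ F1).
  - exact (is_derive_opp _ _ _ F2).
  - exact (is_derive_opp _ _ _ F3).
Qed.

Lemma is_vderive_comp (f : R -> vec3) (h : R -> R) (s m : R) (a : vec3) :
  is_vderive f (h s) a -> is_derive h s m ->
  is_vderive (fun u => f (h u)) s (vscal m a).
Proof.
  intros (H1 & H2 & H3) Hh; split; [| split]; simpl.
  - exact (is_derive_comp _ _ _ _ _ H1 Hh).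
  - exact (is_derive_comp _ _ _ _ _ H2 Hh).
  - exact (is_derive_comp _ _ _ _ _ H3 Hh).
Qed.

Lemma is_derive_Rmult (f g : R -> R) (s a b : R) :
  is_derive f s a -> is_derive g s b ->
  is_derive (fun u => f u * g u) s (a * g s + f s * b).
Proof. intros Ha Hb; apply (is_derive_mult f g); auto; exact Rmult_comm. Qed.

Lemma is_derive_linner (f g : R -> vec3) (s : R) (a b : vec3) :
  is_vderive f s a -> is_vderive g s b ->
  is_derive (fun u => linner (f u) (g u)) s (linner a (g s) + linner (f s) b).
Proof.
  intros (F1 & F2 & F3) (G1 & G2 & G3).
  assert (P1 := is_derive_Rmult _ _ _ _ _ (is_derive_opp _ _ _ F1) G1).
  assert (P2 := is_derive_Rmult _ _ _ _ _ F2 G2).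
  assert (P3 := is_derive_Rmult _ _ _ _ _ F3 G3).
  evar_last.
  - exact (is_derive_plus _ _ _ _ _ (is_derive_plus _ _ _ _ _ P1 P2) P3).
  - unfold linner, plus, opp; simpl; ring.
Qed.

Lemma smooth_is_vderive (I : R -> Prop) (f : R -> vec3) (s : R) :
  smooth_on I f -> I s -> is_vderive f s (vderive f s).
Proof.
  intros Hf Hs; destruct (Hf s Hs 1%nat) as (H1 & H2 & H3).
  split; [| split]; simpl; apply Derive_correct; assumption.
Qed.

(** [frame_g] is bilinear in the ruling and its first derivative, hence the appeal to smoothness at
    orders 1 and 2. *)
Lemma frame_g_is_vderive (I : R -> Prop) (S : ruled_surface) (s : R) :
  smooth_on I (ruling S) -> I s ->
  is_vderive (frame_g S) s (vderive (frame_g S) s).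
Proof.
  intros HS Hs.
  destruct (HS s Hs 1%nat) as (A1 & A2 & A3).
  destruct (HS s Hs 2%nat) as (B1 & B2 & B3).
  simpl in A1, A2, A3, B1, B2, B3.
  split; [| split]; simpl; apply Derive_correct;
    apply (ex_derive_opp (V := R_NormedModule)),
      (ex_derive_minus (V := R_NormedModule));
    apply ex_derive_mult; assumption.
Qed.

(** * Differentiating identities that hold only on an interval *)

Lemma interval_no_isolated_point (I : R -> Prop) (s d : R) :
  is_interval I -> I s -> 0 < d -> exists y, I y /\ y <> s /\ Rabs (y - s) < d.
Proof.
  intros [Hconv (x & z & Hx & Hz & Hxz)] Hs Hd.
  destruct (Rlt_or_le s z) as [Hsz | Hzs].
  (* Half a step towards [z], cut off at [z] to stay in [I]. *)
  - exists (Rmin z (s + d / 2)).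
    assert (B := Rmin_l z (s + d / 2)); assert (C := Rmin_r z (s + d / 2)).
    assert (A : s < Rmin z (s + d / 2)) by (apply Rmin_glb_lt; lra).
    split; [apply (Hconv s _ z); auto; lra | split; [lra |]].
    apply Rabs_def1; lra.
  (* Now [x < z <= s], so there is room on the left, towards [x]. *)
  - exists (Rmax x (s - d / 2)).
    assert (B := Rmax_l x (s - d / 2)); assert (C := Rmax_r x (s - d / 2)).
    assert (A : Rmax x (s - d / 2) < s) by (apply Rmax_lub_lt; lra).
    split; [apply (Hconv x _ s); auto; lra | split; [lra |]].
    apply Rabs_def1; lra.
Qed.

(** [s] may be an endpoint of [I], so [f] need not be constant near [s]. Difference quotients along
    points of [I] vanish, and such points accumulate at [s], which determines the two-sided
    limit. *)
Lemma is_derive_const_on_interval (I : R -> Prop) (f : R -> R) (k s l : R) :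
  is_interval I -> I s -> (forall u, I u -> f u = k) -> is_derive f s l ->
  l = 0.
Proof.
  intros HI Hs Hf Hl.
  destruct (Req_dec l 0) as [-> | Hl0]; [reflexivity | exfalso].
  apply is_derive_Reals in Hl.
  (* With tolerance [|l|], a zero quotient at a nearby point of [I] yields [|l| < |l|]. *)
  destruct (Hl (Rabs l) (Rabs_pos_lt l Hl0)) as [d Hd].
  destruct (interval_no_isolated_point I s d HI Hs (cond_pos d))
    as (y & Iy & Hy & Hyd).
  specialize (Hd (y - s) ltac:(lra) Hyd).
  replace (s + (y - s)) with y in Hd by ring.
  rewrite (Hf y Iy), (Hf s Hs) in Hd.
  replace ((k - k) / (y - s) - l) with (- l) in Hd by (field; lra).
  rewrite Rabs_Ropp in Hd; lra.
Qed.

Lemma linner_const_on_interval (I : R -> Prop) (f g : R -> vec3) (k s : R)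
    (a b : vec3) :
  is_interval I -> I s -> (forall u, I u -> linner (f u) (g u) = k) ->
  is_vderive f s a -> is_vderive g s b ->
  linner a (g s) + linner (f s) b = 0.
Proof.
  intros HI Hs Hk Ha Hb.
  apply (is_derive_const_on_interval I (fun u => linner (f u) (g u)) k s);
    auto; apply is_derive_linner; assumption.
Qed.

(** * Hyperbolic functions *)

Lemma cosh_pos (x : R) : 0 < cosh x.
Proof.
  unfold cosh; assert (H := exp_pos x); assert (H' := exp_pos (- x)); lra.
Qed.

Lemma cosh_sinh_sqr (x : R) : cosh x * cosh x - sinh x * sinh x = 1.
Proof.
  transitivity (exp x * exp (- x)); [unfold cosh, sinh; field |].
  rewrite <- exp_plus, Rplus_opp_r; apply exp_0.
Qed.

Lemma Derive_sinh (x : R) : Derive sinh x = cosh x.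
Proof.
  apply is_derive_unique, is_derive_Reals, derivable_pt_lim_sinh.
Qed.

Lemma Derive_cosh (x : R) : Derive cosh x = sinh x.
Proof.
  apply is_derive_unique, is_derive_Reals, derivable_pt_lim_cosh.
Qed.

Lemma Derive_tanh (x : R) : Derive tanh x = 1 / (cosh x * cosh x).
Proof.
  assert (Hc := cosh_pos x).
  (* The numerator 1 takes the form produced by the quotient rule. *)
  rewrite <- (cosh_sinh_sqr x).
  apply is_derive_unique, is_derive_Reals.
  apply (derivable_pt_lim_div sinh cosh x (cosh x) (sinh x)).
  - apply derivable_pt_lim_sinh.
  - apply derivable_pt_lim_cosh.
  - lra.
Qed.

(** * Frames of the two surfaces at corresponding points *)

Section Offset.

Variables (I I1 : R -> Prop) (S S1 : ruled_surface) (s1 : R -> R)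
  (Theta : R -> dual).
Hypotheses (HI : is_interval I) (HS : spacelike_ruled I S)
  (HS1 : timelike_ruled I1 S1) (Hoffset : mannheim_offset I I1 S S1 s1)
  (Hangle : dual_offset_angle I S S1 s1 Theta).

(** Derivative of [<e, e> = 1]. *)
Lemma frame_e_t_orthogonal (s : R) :
  I s -> linner (frame_e S s) (frame_t S s) = 0.
Proof.
  intros Hs; destruct HS as (_ & Hr & Hframe).
  assert (D := smooth_is_vderive I _ s Hr Hs).
  assert (H := linner_const_on_interval I _ _ 1 s _ _ HI Hs
                 (fun u Hu => proj1 (Hframe u Hu)) D D).
  fold (frame_t S s) in H; fold (frame_e S s) in H.
  rewrite (linner_sym (frame_t S s)) in H; lra.
Qed.

Lemma frame_g_unit (s : R) : I s -> linner (frame_g S s) (frame_g S s) = 1.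
Proof.
  intros Hs; destruct HS as (_ & _ & Hframe).
  destruct (Hframe s Hs) as (He & Ht & _).
  unfold frame_g.
  rewrite linner_oppl, linner_sym, linner_oppl, linner_lcross_lcross.
  rewrite He, Ht, (frame_e_t_orthogonal s Hs); ring.
Qed.

Lemma frame_e_g_orthogonal (S' : ruled_surface) (s : R) :
  linner (frame_e S' s) (frame_g S' s) = 0.
Proof.
  unfold frame_g; rewrite linner_sym, linner_oppl, linner_lcross_l; ring.
Qed.

Lemma frame_t_g_orthogonal (S' : ruled_surface) (s : R) :
  linner (frame_t S' s) (frame_g S' s) = 0.
Proof.
  unfold frame_g; rewrite linner_sym, linner_oppl, linner_lcross_r; ring.
Qed.

(** These are the real parts of the dual relations; the dual parts enter in [striction_gapE]. *)
Lemma offset_frame (s : R) : I s ->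
  frame_e S1 (s1 s) = vadd (vscal (sinh (re (Theta s))) (frame_e S s))
                           (vscal (cosh (re (Theta s))) (frame_t S s)) /\
  frame_t S1 (s1 s) = frame_g S s /\
  frame_g S1 (s1 s) = vadd (vscal (cosh (re (Theta s))) (frame_e S s))
                           (vscal (sinh (re (Theta s))) (frame_t S s)).
Proof.
  intros Hs; destruct (Hangle s Hs) as [He Hg].
  destruct (Hoffset s Hs) as (_ & _ & _ & Ht).
  split; [exact (f_equal vre He) | split; [| exact (f_equal vre Hg)]].
  symmetry; exact (f_equal vre Ht).
Qed.

Lemma offset_g1_unit (s : R) :
  I s -> linner (frame_g S1 (s1 s)) (frame_g S1 (s1 s)) = 1.
Proof.
  intros Hs; destruct HS as (_ & _ & Hframe).
  destruct (Hframe s Hs) as (He & Ht & _).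
  destruct (offset_frame s Hs) as (_ & _ & ->).
  rewrite !linner_addl, !linner_scall, !linner_addr, !linner_scalr.
  rewrite (linner_sym (frame_t S s) (frame_e S s)), He, Ht.
  rewrite (frame_e_t_orthogonal s Hs).
  assert (H := cosh_sinh_sqr (re (Theta s))); lra.
Qed.

(** * The vector joining the striction curves *)

Definition striction_gap (s : R) : vec3 :=
  vadd (striction S1 (s1 s)) (vopp (striction S s)).

(** Write [w] for the gap. The dual part of the Mannheim condition gives [w x g = 0], so [w] is a
    multiple of [g]; the dual part of the relation for [e1] then identifies the coefficient. *)
Lemma striction_gapE (s : R) :
  I s -> striction_gap s = vscal (du (Theta s)) (frame_g S s).
Proof.
  intros Hs.
  destruct (offset_frame s Hs) as (He & Ht & Hg).
  assert (Hw : striction_gap s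
               = vscal (linner (striction_gap s) (frame_g S s)) (frame_g S s)).
  { apply lcross_eq0_unit; [exact (frame_g_unit s Hs) |].
    destruct (Hoffset s Hs) as (_ & _ & _ & Hl).
    apply (f_equal vdu) in Hl; cbn [vdu dual_g dual_t dual_line] in Hl.
    rewrite Ht in Hl; unfold striction_gap; rewrite lcross_subl, <- Hl.
    apply vec3_eq; cbn; ring. }
  (* In the dual part of the [e1] relation, the terms [c x e] and [c x t] combine into [c x e1], and
     the derivatives of [sinh] and [cosh] leave [theta*] times [g1]. *)
  assert (Hx : lcross (striction_gap s) (frame_e S1 (s1 s))
               = vscal (du (Theta s)) (frame_g S1 (s1 s))).
  { destruct (Hangle s Hs) as [H _].
    apply (f_equal vdu) in H.
    cbn [vdu vre re du dual_e dual_t dual_line dvadd dvscal dual_ext] in H.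
    rewrite Derive_sinh, Derive_cosh in H.
    unfold striction_gap; rewrite lcross_subl, H, He, Hg.
    apply vec3_eq; unfold lcross, vadd, vopp, vscal; cbn [vx1 vx2 vx3]; ring. }
  (* Second evaluation of the same product, from [w = <w, g> g] and [g x e1 = t1 x e1 = g1]. *)
  assert (Hy : lcross (striction_gap s) (frame_e S1 (s1 s))
               = vscal (linner (striction_gap s) (frame_g S s))
                       (frame_g S1 (s1 s))).
  { rewrite Hw at 1.
    generalize (linner (striction_gap s) (frame_g S s)); intros k.
    unfold frame_g at 2; rewrite Ht.
    apply vec3_eq; unfold lcross, vopp, vscal; cbn [vx1 vx2 vx3]; ring. }
  rewrite Hy in Hx.
  (* Pairing with the unit vector [g1] isolates the coefficients. *)
  apply (f_equal (linner (frame_g S1 (s1 s)))) in Hx.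
  rewrite !linner_scalr, (offset_g1_unit s Hs), !Rmult_1_r in Hx.
  rewrite <- Hx; exact Hw.
Qed.

Lemma linner_e1_g (s : R) : I s -> linner (frame_e S1 (s1 s)) (frame_g S s) = 0.
Proof.
  intros Hs; destruct (offset_frame s Hs) as (-> & _).
  rewrite linner_addl, !linner_scall, frame_e_g_orthogonal, frame_t_g_orthogonal.
  ring.
Qed.

Lemma linner_g1_g (s : R) : I s -> linner (frame_g S1 (s1 s)) (frame_g S s) = 0.
Proof.
  intros Hs; destruct (offset_frame s Hs) as (_ & _ & ->).
  rewrite linner_addl, !linner_scall, frame_e_g_orthogonal, frame_t_g_orthogonal.
  ring.
Qed.

Lemma linner_gap_e1 (s : R) :
  I s -> linner (striction_gap s) (frame_e S1 (s1 s)) = 0.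
Proof.
  intros Hs; rewrite (striction_gapE s Hs), linner_scall, linner_sym.
  rewrite (linner_e1_g s Hs); ring.
Qed.

Lemma linner_gap_g1 (s : R) :
  I s -> linner (striction_gap s) (frame_g S1 (s1 s)) = 0.
Proof.
  intros Hs; rewrite (striction_gapE s Hs), linner_scall, linner_sym.
  rewrite (linner_g1_g s Hs); ring.
Qed.

(** * Relations obtained by differentiating the orthogonality identities *)

(** Derivatives of, in order, [<e1, g> = 0], [<g1, g> = 0], [<c1 - c, e1> = 0] and
    [<c1 - c, g1> = 0]. Since [t1 = g], the number [p] is minus the conical curvature of [S1]. *)
Lemma offset_derivative_relations (s : R) : I s ->
  let m := Derive s1 s in
  let k := linner (frame_t S s) (vderive (frame_g S) s) in
  let p := linner (vderive (frame_g S1) (s1 s)) (frame_g S s) in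
  let sh := sinh (re (Theta s)) in
  let ch := cosh (re (Theta s)) in
  m + ch * k = 0 /\
  m * p + sh * k = 0 /\
  m * delta S1 (s1 s) - sh * delta S s + du (Theta s) * m = 0 /\
  m * Defs.Delta S1 (s1 s) - ch * delta S s + du (Theta s) * (m * p) = 0.
Proof.
  intros Hs m k p sh ch.
  destruct HS as (Hc & Hr & Hframe), HS1 as (Hc1 & Hr1 & _).
  destruct (Hframe s Hs) as (He & Ht & Hct).
  destruct (Hoffset s Hs) as (Hs1 & Hd & _ & _).
  apply Derive_correct in Hd; fold m in Hd.
  destruct (offset_frame s Hs) as (Ee & Et & Eg); fold sh ch in Ee, Eg.
  assert (De := smooth_is_vderive I _ s Hr Hs).
  assert (Dg := frame_g_is_vderive I S s Hr Hs).
  assert (Dc := smooth_is_vderive I _ s Hc Hs).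
  assert (De1 := is_vderive_comp _ _ _ _ _
                   (smooth_is_vderive I1 _ _ Hr1 Hs1) Hd).
  assert (Dg1 := is_vderive_comp _ _ _ _ _
                   (frame_g_is_vderive I1 S1 _ Hr1 Hs1) Hd).
  assert (Dw := is_vderive_add _ _ _ _ _
                  (is_vderive_comp _ _ _ _ _
                     (smooth_is_vderive I1 _ _ Hc1 Hs1) Hd)
                  (is_vderive_opp _ _ _ Dc)).
  fold (frame_t S1 (s1 s)) in De1; fold (frame_t S s) in De.
  (* Derivative of [<e, g> = 0], using [<t, g> = 0]: only the [t]-components of [e1] and [g1] will
     pair with the derivative of [g]. *)
  assert (Heg : linner (frame_e S s) (vderive (frame_g S) s) = 0).
  { assert (H := linner_const_on_interval I (frame_e S) _ 0 s _ _ HI Hs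
                   (fun u _ => frame_e_g_orthogonal S u) De Dg).
    rewrite frame_t_g_orthogonal in H; lra. }
  split; [| split; [| split]].
  - assert (H := linner_const_on_interval I (fun u => frame_e S1 (s1 u)) _ 0 s
                   _ _ HI Hs linner_e1_g De1 Dg).
    simpl in H; rewrite Et, Ee in H.
    rewrite linner_addl, !linner_scall, (frame_g_unit s Hs), Heg in H.
    fold k in H; lra.
  - assert (H := linner_const_on_interval I (fun u => frame_g S1 (s1 u)) _ 0 s
                   _ _ HI Hs linner_g1_g Dg1 Dg).
    simpl in H; rewrite Eg in H.
    rewrite linner_addl, !linner_scall, Heg in H.
    fold k p in H; lra.
  - assert (H := linner_const_on_interval I striction_gap
                   (fun u => frame_e S1 (s1 u)) 0 s _ _ HI Hs
                   linner_gap_e1 Dw De1).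
    simpl in H.
    rewrite (striction_gapE s Hs), Et in H.
    rewrite linner_addl, linner_oppl, linner_scall in H.
    fold (delta S1 (s1 s)) in H.
    rewrite Ee in H.
    rewrite linner_addr, !linner_scalr, Hct, linner_scall in H.
    rewrite (frame_g_unit s Hs) in H.
    fold (delta S s) in H; lra.
  - assert (H := linner_const_on_interval I striction_gap
                   (fun u => frame_g S1 (s1 u)) 0 s _ _ HI Hs
                   linner_gap_g1 Dw Dg1).
    simpl in H.
    rewrite (striction_gapE s Hs) in H.
    rewrite linner_addl, linner_oppl, linner_scall in H.
    unfold Defs.Delta; rewrite det3_linner; fold (frame_g S1 (s1 s)).
    rewrite linner_scall, linner_scalr, (linner_sym (frame_g S s)) in H.
    fold p in H; revert H.
    (* Abstracting this product, which is [Delta] of [S1], keeps it whole while [g1] is expanded in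
       its pairing with the derivative of [c]. *)
    generalize (linner (vderive (striction S1) (s1 s)) (frame_g S1 (s1 s))).
    rewrite Eg, linner_addr, !linner_scalr, Hct.
    fold (delta S s); intros; lra.
Qed.

End Offset.

(** * Elimination among the four relations *)

Theorem theorem5p7 (I I1 : R -> Prop) (S S1 : ruled_surface)
    (s1 : R -> R) (Theta : R -> dual)
    (HI : is_interval I) (HI0 : I 0) (HI1 : is_interval I1)
    (HS : spacelike_ruled I S) (HS1 : timelike_ruled I1 S1)
    (Hoffset : mannheim_offset I I1 S S1 s1)
    (Hangle : dual_offset_angle I S S1 s1 Theta) :
  forall s, I s ->
    dual_conical_curvature S1 (s1 s) = dopp (dual_ext tanh (Theta s)).
Proof.
  intros s Hs.
  destruct (offset_derivative_relations I I1 S S1 s1 Theta HI HS HS1 Hoffset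
              Hangle s Hs) as (R1 & R2 & R3 & R4).
  destruct (offset_frame I I1 S S1 s1 Theta Hoffset Hangle s Hs) as (_ & Et & _).
  destruct (Hoffset s Hs) as (_ & _ & Hm & _).
  assert (Hch := cosh_pos (re (Theta s))).
  assert (Hsq := cosh_sinh_sqr (re (Theta s))).
  unfold dual_conical_curvature, conical_curvature, dopp, dual_ext; simpl.
  rewrite Et, Derive_tanh; unfold tanh.
  revert R1 R2 R3 R4 Hm Hch Hsq.
  generalize (Derive s1 s) (linner (frame_t S s) (vderive (frame_g S) s))
    (linner (vderive (frame_g S1) (s1 s)) (frame_g S s))
    (sinh (re (Theta s))) (cosh (re (Theta s))) (delta S1 (s1 s))
    (Defs.Delta S1 (s1 s)) (delta S s) (du (Theta s)).
  intros m k p sh ch d1 D1 d ts R1 R2 R3 R4 Hm Hch Hsq.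
  (* The first two relations read [m = - ch * k] and [m * p = - sh * k]. *)
  assert (Hp : p = sh / ch).
  { apply (Rmult_eq_reg_l m); [| exact Hm].
    replace (m * p) with (- (sh * k)) by lra.
    replace m with (- (ch * k)) by lra.
    field; lra. }
  (* The last two relations are combined so that [d] appears with the coefficient [sh - p * ch],
     which is zero. *)
  assert (HD : m * (d1 - p * D1) = - ts * m * (1 - p * p)).
  { replace (m * (d1 - p * D1)) with (m * d1 - p * (m * D1)) by ring.
    replace (m * d1) with (sh * d - ts * m) by lra.
    replace (m * D1) with (ch * d - ts * (m * p)) by lra.
    rewrite Hp; field; lra. }
  f_equal; [rewrite Hp; reflexivity |].
  apply (Rmult_eq_reg_l m); [| exact Hm].
  transitivity (m * (d1 - p * D1)); [ring |].
  rewrite HD, Hp.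
  (* The factor [1 - p * p] is [1 / (ch * ch)], the derivative of [tanh]. *)
  transitivity (- ts * m * (ch * ch - sh * sh) / (ch * ch)); [field; lra |].
  rewrite Hsq; field; lra.
Qed.
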